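(* There is a universal constant $c>0$ such that for every compact convex set $C\subset\mathbb{R}^2$ with nonempty interior and every integer $n\ge 3$, if $\xi_n$ is a set of $n$ independent random points chosen uniformly from $C$, then $$\mathbb{E}(\deg \xi_n)\ \ge\ \frac{c\,n}{\ln n}.$$
   Context: A finite set $X\subset\mathbb{R}^2$ is in general position if no three of its points are collinear. For such $X$ and a triple $\{x_1,x_2,x_3\}$ of distinct points of $X$, the triangle $t=\mathrm{conv}\{x_1,x_2,x_3\}$ is called empty (in $X$) if $t\cap X=\{x_1,x_2,x_3\}$. For a pair $\{x,y\}$ of distinct points of $X$, its degree $\deg(x,y;X)$ is the number of points $z\in X\setminus\{x,y\}$ such that $\{x,y,z\}$ determines an empty triangle in $X$. Define $\deg X=\max\deg(x,y;X)$, the maximum being over all two-element subsets $\{x,y\}$ of $X$. The random set $\xi_n$ consists of $n$ independent points each uniformly distributed in $C$ (normalized Lebesgue measure); it has $n$ points and is in general position with probability one, so $\deg\xi_n$ is almost surely well defined. $\ln$ is the natural logarithm. *)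

(* Defs.v *)
From HB Require Import structures.
From mathcomp Require Export all_boot all_order all_algebra finmap.
From mathcomp Require Export all_classical all_reals all_analysis.
Export Order.TTheory GRing.Theory Num.Theory.
Export numFieldNormedType.Exports.

Set Implicit Arguments.
Unset Strict Implicit.
Unset Printing Implicit Defensive.

Local Open Scope classical_set_scope.
Local Open Scope ring_scope.

Section Degree.
Variable R : realType.
Implicit Types (X : {fset R * R}) (x y z : R * R).

Definition convex_hull (A : set (R * R)) : set (R * R) :=
  smallest (fun D : set (R * R) => convex_set D) A.

Definition empty_triangle X x y z : Prop :=
  convex_hull [set x; y; z] `&` [set` X] = [set x; y; z].

Definition pair_degree X x y : nat :=
  #|` [fset z in X | (z \notin [:: x; y]) && `[< empty_triangle X x y z >]]%fset|.

(* The maximum runs over ordered pairs, which is harmless since [pair_degree]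
   is symmetric; sets with fewer than two points get degree 0. *)
Definition degree X : nat :=
  \max_(x <- X) \max_(y <- X | y != x) pair_degree X x y.

End Degree.

Section RandomPoints.
Local Open Scope ereal_scope.
Context (R : realType) (d : measure_display) (T : measurableType d).
Variable P : probability T R.

Definition mutually_independent (d' : measure_display) (T' : measurableType d')
    (I : finType) (X : I -> {RV P >-> T'}) : Prop :=
  forall (J : {set I}) (A : I -> set T'), (forall i, measurable (A i)) ->
    P (\bigcap_(i in [set` J]) (X i @^-1` A i)) =
    \prod_(i in J) P (X i @^-1` A i).

Definition area (A : set (R * R)) : \bar R :=
  (lebesgue_measure \x lebesgue_measure) A.

Definition uniformly_distributed_on (C : set (R * R))
    (X : {RV P >-> (R * R)%type}) : Prop :=
  forall A : set (R * R), measurable A ->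
    distribution P X A = area (A `&` C) / area C.

Definition random_set (n : nat) (xi : 'I_n -> {RV P >-> (R * R)%type}) (w : T) :
    {fset R * R} :=
  [fset xi i w | i : 'I_n]%fset.

End RandomPoints.

(* Main.v *)
Require Import Defs.
From HB Require Import structures.
From mathcomp Require Import ring lra measurable_realfun.
Local Open Scope classical_set_scope.
Local Open Scope ring_scope.

Set Implicit Arguments.
Unset Strict Implicit.
Unset Printing Implicit Defensive.

(** The degree of a random set is already forced to be linear in [n] by one
pair of points that happen to lie very close to each other.

Call the ordered pair [(x, y)] close when [x] lies in [C] and [y] lies in the
copy of [C] shrunk towards [x] by the factor [1/r], with [r] equal to [16 n].
This notion is affinely invariant, so no normalization of [C] is needed, and
the convexity of [C] keeps the small copy inside [C]: for independent uniform
points the pair is close with probability exactly [r^-2] ([prob_close]).  When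
[(x, y)] is close, every triangle [x y z] with [z] in [C] occupies at most a
proportion [8 / r] of [C] ([area_thin_triangle]): half-size copies of the
triangle, translated in the direction of [y - x], fit disjointly into [C], and
there is room for many of them because the triangle is thin
([area_packing]).  Hence a given point [xi_l] falls into the triangle of a
close pair [(xi_i, xi_j)] and of [xi_k] with conditional probability at most
[8 / r], and the union bound over [l] shows that the triangle is empty with
conditional probability at least [1/2].

On the other hand there are about [n^2 / 2] pairs, and two given pairs are
simultaneously close with probability of order [r^-4] only, so that a close
pair is likely to be the only one.  Let [good i j k] be the event that [(i, j)]
is the only close pair, that no fourth point falls into the triangle on
[i, j, k], and that the points are distinct and lie in [C].  Then [good i j k]
has probability at least [r^-2 / 4] ([prob_good]); and since at most one pair
is involved at a time, the number of triples [i < j, k] whose good event occurs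
is at most the degree ([good_le_degree]).  Summing over all triples gives an
expectation of at least [n^3 * r^-2] up to a constant, that is, of order [n],
and [n / ln n] is at most [n / ln 2].

The joint laws involved are computed by revealing one point last: a point is
independent of the sigma-algebra generated by all the others
([others_independent]), so the probability of an event is the integral of its
probability conditional on the others ([freeze_le], [freeze_eq]). *)

(** * Affine maps and area *)

(** The measure structure of a pushforward depends on a proof that [f] is
measurable, which unification cannot find; here it is an argument. *)
Definition image_measure d d' (T : measurableType d) (T' : measurableType d')
    (R : realType) (m : {measure set T -> \bar R}) (f : T -> T')
    (mf : measurable_fun setT f) : {measure set T' -> \bar R} :=
  measure_function_pushforward__canonical__measure_function_Measure m mf.

Section Area.
Variable R : realType.

Lemma measurable_affine (s q : R) : measurable_fun setT (fun x : R => s * x + q).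
Proof.
apply: measurable_funD; last exact: measurable_cst.
by apply: measurable_funM => //; exact: measurable_cst.
Qed.

Lemma preimage_measurable d d' (T : measurableType d) (T' : measurableType d')
    (f : T -> T') (A : set T') :
  measurable_fun setT f -> measurable A -> measurable (f @^-1` A).
Proof. by move=> mf mA; rewrite -[X in measurable X]setTI; exact: mf. Qed.

(** It is enough to compare the two sides on half-open intervals; a negative
[s] turns them into intervals that are open on the other side. *)
Lemma lebesgue_measure_affine (s q : R) (A : set R) : s != 0 -> measurable A ->
  (lebesgue_measure A = `|s|%:E * lebesgue_measure ((fun x => (s * x + q)%R) @^-1` A))%E.
Proof.
move=> s0 mA.
have ns : 0 <= `|s| by [].
pose f : measurableTypeR R -> measurableTypeR R := fun x => (s : R) * (x : R) + q.
have mf : measurable_fun setT f by exact: measurable_affine.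
pose m' := image_measure (@lebesgue_measure R) mf.
have := @lebesgue_measure_unique R (mscale (NngNum ns) m').
apply => // _ [[a b] _ <-] /=.
rewrite /mscale /= /pushforward lebesgue_measure_itv /=.
have : 0 < s \/ s < 0 by move: s0; rewrite neq_lt => /orP[]; [right|left].
case=> hs.
- have -> : f @^-1` `]a, b]%classic = `](a - q) / s, (b - q) / s]%classic.
    apply/seteqP; split=> x /=; rewrite !in_itv /= /f.
      move=> /andP[h1 h2]; rewrite ltr_pdivrMr // ler_pdivlMr //; apply/andP; split; lra.
    move=> /andP[]; rewrite ltr_pdivrMr // ler_pdivlMr // => h1 h2; apply/andP; split; lra.
  rewrite lebesgue_measure_itv /= !lte_fin ltr_pM2r ?invr_gt0 // ltrD2r gtr0_norm //.
  case: ifP => _; last by rewrite mule0.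
  by rewrite -!EFinB -EFinM; congr EFin; field.
- have -> : f @^-1` `]a, b]%classic = `[(b - q) / s, (a - q) / s[%classic.
    apply/seteqP; split=> x /=; rewrite !in_itv /= /f.
      move=> /andP[h1 h2]; rewrite ler_ndivrMr // ltr_ndivlMr //; apply/andP; split; lra.
    move=> /andP[]; rewrite ler_ndivrMr // ltr_ndivlMr // => h1 h2; apply/andP; split; lra.
  rewrite lebesgue_measure_itv /= !lte_fin ltr_nM2r ?invr_lt0 // ltrD2r ltr0_norm //.
  case: ifP => _; last by rewrite mule0.
  by rewrite -!EFinB -EFinM; congr EFin; field.
Qed.

Definition homothety (s : R) (q p : R * R) : R * R :=
  (s * p.1 + q.1, s * p.2 + q.2).

Lemma measurable_homothety s q : measurable_fun setT (homothety s q).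
Proof.
apply: measurable_fun_pair.
- by apply: (measurableT_comp (measurable_affine s q.1)); exact: measurable_fst.
- by apply: (measurableT_comp (measurable_affine s q.2)); exact: measurable_snd.
Qed.

(** The measurable structure on which [area] is built as a product measure and
the canonical one of the plane are convertible, so [area] inherits the axioms of
measures for the canonical one. *)
Lemma area_ge0 A : (0 <= @area R A)%E.
Proof. exact: (measure_ge0 (@lebesgue_measure R \x @lebesgue_measure R)%E). Qed.

HB.instance Definition _ := isMeasure.Build _ (R * R)%type R (@area R)
  (measure0 (@lebesgue_measure R \x @lebesgue_measure R)%E) area_ge0
  (@measure_semi_sigma_additive _ _ _ (@lebesgue_measure R \x @lebesgue_measure R)%E).

(** Both sides are measures in [A] that agree on rectangles. *)
Lemma area_homothety s q (A : set (R * R)) : s != 0 -> measurable A ->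
  (area A = (s ^+ 2)%:E * area (homothety s q @^-1` A))%E.
Proof.
move=> s0 mA.
have ns : 0 <= s ^+ 2 by rewrite sqr_ge0.
pose f : measurableTypeR R * measurableTypeR R ->
  measurableTypeR R * measurableTypeR R := homothety s q.
have mf : measurable_fun setT f by exact: measurable_homothety.
pose m' := image_measure (@lebesgue_measure R \x @lebesgue_measure R)%E mf.
have := @product_measure_unique _ _ _ _ R (@lebesgue_measure R) (@lebesgue_measure R)
  (mscale (NngNum ns) m').
apply => // B D mB mD.
have E := @product_measure1E _ _ _ _ R (@lebesgue_measure R) (@lebesgue_measure R)
  ((fun x => s * x + q.1) @^-1` B) ((fun x => s * x + q.2) @^-1` D).
change ((s ^+ 2)%:E * (@lebesgue_measure R \x @lebesgue_measure R)
  (((fun x => s * x + q.1)%R @^-1` B) `*` ((fun x => s * x + q.2)%R @^-1` D)) =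
  lebesgue_measure B * lebesgue_measure D)%E.
rewrite E; try by apply: preimage_measurable => //; exact: measurable_affine.
have hB := @lebesgue_measure_affine s q.1 B s0 mB.
have hD := @lebesgue_measure_affine s q.2 D s0 mD.
rewrite [in RHS]hB [in RHS]hD muleACA -EFinM; congr (_%:E * _)%E.
by rewrite -normrM -expr2 ger0_norm.
Qed.
End Area.

(** * Compact sets of the plane are measurable *)

Section Borel.
Variable R : realType.

(** An open set is the union of the rational boxes that it contains. *)
Lemma open_measurable_prod (U : set (R * R)) : open U -> measurable U.
Proof.
move=> oU.
pose box (q : rat * rat * (rat * rat)) : set (R * R) :=
  `]ratr q.1.1, ratr q.1.2[%classic `*` `]ratr q.2.1, ratr q.2.2[%classic.
pose F q := if `[< box q `<=` U >] then box q else set0.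
have -> : U = \bigcup_q F q.
  apply/seteqP; split=> [[x y] Uxy|z [q _]]; last first.
    by rewrite /F; case: asboolP => // qU; exact: qU.
  have [[A B] /= [nA nB] AB] : nbhs (x, y) U by exact: open_nbhs_nbhs.
  have [e e0 eA] := (nbhs_ballP _ _).1 nA.
  have [e' e'0 eB] := (nbhs_ballP _ _).1 nB.
  have rat_near (t r : R) : 0 < r -> exists q : rat * rat,
      ratr q.1 < t /\ t < ratr q.2 /\
      (forall s, ratr q.1 < s -> s < ratr q.2 -> ball t r s).
    move=> r0.
    have [a] := @rat_in_itvoo R (t - r) t ltac:(lra).
    have [b] := @rat_in_itvoo R t (t + r) ltac:(lra).
    rewrite !in_itv /= => /andP[b1 b2] /andP[a1 a2].
    exists (a, b) => /=; split => //; split => // s h1 h2.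
    by rewrite -ball_normE /= ltr_norml; apply/andP; split; lra.
  have [q [q1 [q2 q3]]] := rat_near x e e0.
  have [q' [q1' [q2' q3']]] := rat_near y e' e'0.
  exists (q, q') => //.
  have sub : box (q, q') `<=` U.
    move=> [s t] [] /=; rewrite !in_itv /= => /andP[s1 s2] /andP[t1 t2].
    by apply: AB; split => /=; [apply: eA; apply: q3|apply: eB; apply: q3'].
  rewrite /F; case: asboolP => // _; split; rewrite /= in_itv /=; exact/andP.
apply: countable_bigcupT_measurable; first exact: countableP.
move=> q; rewrite /F; case: asboolP => // _.
by apply: measurableX; exact: measurable_itv.
Qed.

Lemma closed_measurable_prod (A : set (R * R)) : closed A -> measurable A.
Proof.
move=> cA; rewrite -(setCK A); apply: measurableC.
by apply: open_measurable_prod; rewrite openC.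
Qed.

Lemma compact_measurable_prod (A : set (R * R)) : compact A -> measurable A.
Proof.
move=> cA; apply: closed_measurable_prod; exact: compact_closed (@norm_hausdorff _ _) cA.
Qed.
End Borel.

(** * Thin triangles in a convex set *)

Section Geometry.
Variable R : realType.
Implicit Types (x y z w a b : R * R) (C : set (R * R)).

Definition line_point (t : R) x y : R * R :=
  ((1 - t) * x.1 + t * y.1, (1 - t) * x.2 + t * y.2).

Lemma convex_segment C x y t : convex_set C -> C x -> C y -> 0 <= t -> t <= 1 ->
  C (line_point t x y).
Proof.
rewrite /line_point => cC Cx Cy t0 t1.
have := cC y x (Itv01 t0 t1); rewrite !inE => /(_ Cy Cx).
rewrite /conv /= => h; rewrite addrC [X in (_, X)]addrC; exact: h.
Qed.

(** Twice the signed area of the triangle with vertices [x], [y], [z]. *)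
Definition det x y z := (y.1 - x.1) * (z.2 - x.2) - (y.2 - x.2) * (z.1 - x.1).

(** This is the triangle with vertices [x], [y], [z] if they are not collinear.
If they are, but do not all coincide, it is the line through them, which is
harmless since a line has no area; the point of the definition is that membership
is visibly measurable in all four points. *)
Definition triangle x y z : set (R * R) :=
  [set w | [/\ 0 <= det y z w, 0 <= det z x w & 0 <= det x y w] \/
           [/\ det y z w <= 0, det z x w <= 0 & det x y w <= 0]].

Lemma conv_pair (a b : R * R) (t : {i01 R}) :
  conv t (a : convex_lmodType (R * R)%type) b =
  (t%:num * a.1 + (1 - t%:num) * b.1, t%:num * a.2 + (1 - t%:num) * b.2).
Proof. by []. Qed.

(** The three vertices satisfy one of the two systems of inequalities,
depending on the orientation of the triangle, and each system is convex. *)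
Lemma convex_hull_triangle x y z : convex_hull [set x; y; z] `<=` triangle x y z.
Proof.
have hull D : convex_set D -> D x -> D y -> D z ->
    convex_hull [set x; y; z] `<=` D.
  by move=> cD Dx Dy Dz; apply: smallest_sub => // w [[->|->]|->].
have [D0|D0] := leP 0 (det x y z).
- apply: (@subset_trans _
    [set w | [/\ 0 <= det y z w, 0 <= det z x w & 0 <= det x y w]]).
    apply: hull => /=; try by move: D0; rewrite /det => D0; split; lra.
    move=> u v t; rewrite !inE conv_pair /det /= => -[u1 u2 u3] [v1 v2 v3].
    have t0 : 0 <= t%:num by [].
    have t1 : 0 <= 1 - t%:num by rewrite subr_ge0.
    by split; [have := addr_ge0 (mulr_ge0 t0 u1) (mulr_ge0 t1 v1)|
     have := addr_ge0 (mulr_ge0 t0 u2) (mulr_ge0 t1 v2)|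
     have := addr_ge0 (mulr_ge0 t0 u3) (mulr_ge0 t1 v3)]; lra.
  by move=> w; left.
- apply: (@subset_trans _
    [set w | [/\ det y z w <= 0, det z x w <= 0 & det x y w <= 0]]).
    apply: hull => /=; try by move: D0; rewrite /det => D0; split; lra.
    move=> u v t; rewrite !inE conv_pair /det /= => -[u1 u2 u3] [v1 v2 v3].
    have t0 : 0 <= t%:num by [].
    have t1 : 0 <= 1 - t%:num by rewrite subr_ge0.
    have le0 (a b : R) : a <= 0 -> b <= 0 -> 0 <= t%:num * - a + (1 - t%:num) * - b.
      by move=> a0 b0; rewrite addr_ge0 // mulr_ge0 // oppr_ge0.
    by split; [have := le0 _ _ u1 v1|have := le0 _ _ u2 v2|
      have := le0 _ _ u3 v3]; lra.
  by move=> w; right.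
Qed.

(** Suppose that the width of [A] with respect to a linear form is less than
[1/m] times the increment of this form from [x] to [b].  Then the translates of
[A] by the multiples of [(b - x) / m] are disjoint.  Shrunk by [1/2], the [k]th
of them consists of the midpoints of the points of [A] and of the [k]th
subdivision point of the segment from [x] to [b], so it lies in [C] when
[k < m]: the set [C] contains [m] disjoint copies of [A] of a quarter of its
area. *)
Lemma area_packing C (A : set (R * R)) x b (al be : R) (m : nat) :
  convex_set C -> measurable C -> measurable A -> A `<=` C -> C x -> C b ->
  (forall u v, A u -> A v -> m%:R * (al * (u.1 - v.1) + be * (u.2 - v.2))
     < al * (b.1 - x.1) + be * (b.2 - x.2)) ->
  (m%:R%:E * area A <= 4%:E * area C)%E.
Proof.
move=> cC mC mA AC Cx Cb hA.
have [->|/set0P[a0 Aa0]] := eqVneq A set0.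
  by rewrite measure0 mule0 mule_ge0.
have [->|m0] := posnP m; first by rewrite mul0e mule_ge0.
have mR : 0 < m%:R :> R by rewrite ltr0n.
have pos : 0 < al * (b.1 - x.1) + be * (b.2 - x.2).
  by have := hA _ _ Aa0 Aa0; rewrite !subrr !mulr0 addr0 mulr0.
(* [F k] is the set of midpoints of [A] and of [x + (k / m) (b - x)], written as
   a preimage under the inverse map. *)
pose q (k : nat) : R * R :=
  (- x.1 - k%:R / m%:R * (b.1 - x.1), - x.2 - k%:R / m%:R * (b.2 - x.2)).
pose F k := homothety 2 (q k) @^-1` A.
have mF k : measurable (F k).
  by apply: preimage_measurable => //; exact: measurable_homothety.
have disj k k' u : (k < k')%N -> F k u -> F k' u -> False.
  move=> kk' h h'; have := hA _ _ h h'; rewrite /homothety /q /=.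
  have : k%:R + 1 <= k'%:R :> R by rewrite natr1 ler_nat.
  move=> hk; rewrite ltNge => /negP; apply.
  set L := al * (b.1 - x.1) + be * (b.2 - x.2) in pos *.
  have -> : m%:R * (al * (2 * u.1 + (- x.1 - k%:R / m%:R * (b.1 - x.1)) -
   (2 * u.1 + (- x.1 - k'%:R / m%:R * (b.1 - x.1)))) +
     be * (2 * u.2 + (- x.2 - k%:R / m%:R * (b.2 - x.2)) -
   (2 * u.2 + (- x.2 - k'%:R / m%:R * (b.2 - x.2))))) = (k'%:R - k%:R) * L.
    by rewrite /L; field; rewrite gt_eqF.
  by rewrite ler_peMl ?(ltW pos) //; lra.
have tF : trivIset setT F.
  apply/trivIsetP => k k' _ _; rewrite neq_lt => /orP[] kk';
   apply/seteqP; split => // u []; [move=> h h'|move=> h' h]; exact: disj kk' h h'.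
have FC k : (k < m)%N -> F k `<=` C.
  move=> km u Fu.
  have t1 : k%:R / m%:R <= 1 :> R by rewrite ler_pdivrMr // mul1r ler_nat ltnW.
  have t0 : 0 <= k%:R / m%:R :> R by rewrite divr_ge0.
  have C1 := convex_segment cC Cx Cb t0 t1.
  have := convex_segment cC C1 (AC _ Fu) (_ : 0 <= 2^-1) (_ : 2^-1 <= 1).
  rewrite /line_point /=.
  have -> : (fun P : R * R => P) ((1 - 2^-1) *
      ((1 - k%:R / m%:R) * x.1 + k%:R / m%:R * b.1) +
      2^-1 * (2 * u.1 + (- x.1 - k%:R / m%:R * (b.1 - x.1))),
      (1 - 2^-1) *
      ((1 - k%:R / m%:R) * x.2 + k%:R / m%:R * b.2) +
      2^-1 * (2 * u.2 + (- x.2 - k%:R / m%:R * (b.2 - x.2)))) = u.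
    by case: u {Fu} => u1 u2 /=; congr (_, _); field; rewrite gt_eqF.
  by apply; lra.
have mU : measurable (\big[setU/set0]_(k < m) F k) by apply: bigsetU_measurable.
have := @measure_semi_additive _ _ _ (@area R) F m mF tF mU.
have : (area (\big[setU/set0]_(k < m) F k) <= area C)%E.
  apply: le_measure; rewrite ?inE //.
  by move=> u; rewrite -bigcup_mkord => -[k /= km]; exact: FC.
move=> le1 E; rewrite E in le1.
have -> : (m%:R%:E * area A = 4%:E * \sum_(k < m) area (F k))%E.
  rewrite ge0_sume_distrr; last by move=> k _; exact: measure_ge0.
  rewrite (eq_bigr (fun=> area A)); last first.
    move=> k _; rewrite (@area_homothety _ 2 (q k) A) //.
    by congr (_%:E * _)%E; lra.
  by rewrite sumr_const card_ord mule_natl.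
by rewrite lee_pmul2l // lte_fin.
Qed.
(** Three non-collinear points near an interior point cannot all lie on the
given line. *)
Lemma interior_off_line C (al be ga : R) : C° !=set0 -> (al, be) != (0, 0) ->
  exists2 b, C b & al * b.1 + be * b.2 != ga.
Proof.
move=> [p /nbhs_ballP[e /= e0 eC]] ab0; apply: contrapT => noC.
have onl b : C b -> al * b.1 + be * b.2 = ga.
  by move=> Cb; apply: contrapT => /eqP nb; apply: noC; exists b.
have inC (s t : R) : `|s| < e -> `|t| < e -> C (p.1 + s, p.2 + t).
  move=> se te; apply: eC; split; rewrite /= -ball_normE /=.
    by rewrite opprD addNKr normrN.
  by rewrite opprD addNKr normrN.
have e2 : `|e / 2| < e by rewrite gtr0_norm; lra.
have z0 : `|0 : R| < e by rewrite normr0.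
have h0 := onl _ (inC _ _ z0 z0); have h1 := onl _ (inC _ _ e2 z0).
have h2 := onl _ (inC _ _ z0 e2); rewrite /= in h0 h1 h2.
have a0 : al * e = 0 by lra.
have b0 : be * e = 0 by lra.
move: ab0; rewrite -pair_eqE /= /pair_eq /=.
move/eqP: a0; rewrite mulf_eq0 (gt_eqF e0) orbF => ->.
by move/eqP: b0; rewrite mulf_eq0 (gt_eqF e0) orbF => ->.
Qed.

Lemma measurable_coordinates d (T : measurableType d) (f : T -> R * R) :
  measurable_fun setT f ->
  measurable_fun setT (fun t => (f t).1) /\ measurable_fun setT (fun t => (f t).2).
Proof.
by move=> mf; split; [exact: (measurableT_comp measurable_fst mf)|
  exact: (measurableT_comp measurable_snd mf)].
Qed.

Lemma measurable_det d (T : measurableType d) (f g h : T -> R * R) :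
  measurable_fun setT f -> measurable_fun setT g -> measurable_fun setT h ->
  measurable_fun setT (fun t => det (f t) (g t) (h t)).
Proof.
move=> /measurable_coordinates[? ?] /measurable_coordinates[? ?].
move=> /measurable_coordinates[? ?].
by apply: measurable_funB; apply: measurable_funM; exact: measurable_funB.
Qed.

Lemma measurable_in_triangle d (T : measurableType d) (x y z w : T -> R * R) :
  measurable_fun setT x -> measurable_fun setT y -> measurable_fun setT z ->
  measurable_fun setT w ->
  measurable [set t | triangle (x t) (y t) (z t) (w t)].
Proof.
move=> mx my mz mw.
have m0 : measurable_fun setT (fun _ : T => 0 : R) by exact: measurable_cst.
have ge (f : T -> R) : measurable_fun setT f -> measurable [set t | 0 <= f t].
  by move=> mf; rewrite -[X in measurable X]setTI; exact: measurable_fun_le.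
have le (f : T -> R) : measurable_fun setT f -> measurable [set t | f t <= 0].
  by move=> mf; rewrite -[X in measurable X]setTI; exact: measurable_fun_le.
rewrite (_ : [set t | _] =
  ([set t | 0 <= det (y t) (z t) (w t)] `&` [set t | 0 <= det (z t) (x t) (w t)]
    `&` [set t | 0 <= det (x t) (y t) (w t)]) `|`
  ([set t | det (y t) (z t) (w t) <= 0] `&` [set t | det (z t) (x t) (w t) <= 0]
    `&` [set t | det (x t) (y t) (w t) <= 0])).
  by apply: measurableU; apply: measurableI; try apply: measurableI;
    (apply: ge || apply: le); exact: measurable_det.
apply/seteqP; split=> t /= [].
- by case=> *; left.
- by case=> *; right.
- by case=> -[] *; left.
- by case=> -[] *; right.
Qed.

Lemma measurable_coincide d (T : measurableType d) (x y : T -> R * R) :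
  measurable_fun setT x -> measurable_fun setT y -> measurable [set t | x t = y t].
Proof.
move=> mx my.
have eqm (f g : T -> R) : measurable_fun setT f -> measurable_fun setT g ->
    measurable [set t | f t = g t].
  move=> mf mg.
  rewrite (_ : [set t | _] = [set t | f t <= g t] `&` [set t | g t <= f t]).
    by apply: measurableI; rewrite -[X in measurable X]setTI; exact: measurable_fun_le.
  apply/seteqP; split => t /=; first by move=> ->.
  by move=> [fg gf]; apply/eqP; rewrite eq_le fg.
rewrite (_ : [set t | _] = [set t | (x t).1 = (y t).1] `&` [set t | (x t).2 = (y t).2]).
  have [? ?] := measurable_coordinates mx; have [? ?] := measurable_coordinates my.
  by apply: measurableI; exact: eqm.
by apply/seteqP; split => t /=; case: (x t) (y t) => a b [a' b'] /= -[-> ->].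
Qed.

(** With [a] the point of [C] such that [y - x] is [(a - x) / (2 m)], the packing
goes along the segment from [x] to [a], separated by the linear part of
[det z x]: on the triangle its range has length at most [|det x y z|], while it
grows by [2 m |det x y z|] from [x] to [a].  If the three points are collinear,
this form is constant on the triangle and any point [b] of [C] off the line
does. *)
Lemma area_thin_triangle C x y z (m : nat) : convex_set C -> measurable C ->
  C° !=set0 -> C x -> C z -> z != x -> C (line_point (m%:R *+ 2) x y) ->
  (m%:R%:E * area (triangle x y z `&` C) <= 4%:E * area C)%E.
Proof.
move=> cC mC iC Cx Cz zx Ca.
have mT : measurable (triangle x y z `&` C).
  apply: measurableI => //.
  by apply: (@measurable_in_triangle _ _ (fun=> x) (fun=> y) (fun=> z) id);
    (exact: measurable_cst || exact: measurable_id).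
have [->|m0] := posnP m; first by rewrite mul0e mule_ge0.
have mR : 0 < m%:R :> R by rewrite ltr0n.
have TC : triangle x y z `&` C `<=` C by move=> ? [].
have sumE w : det y z w + det z x w + det x y w = det x y z by rewrite /det; ring.
have [D0|D0|D0] := ltgtP (det x y z) 0.
- apply: (@area_packing C _ x _ (x.2 - z.2) (- (x.1 - z.1)) m cC mC mT TC Cx Ca).
  move=> u v [Tu _] [Tv _].
  have -> : (x.2 - z.2) * (u.1 - v.1) + - (x.1 - z.1) * (u.2 - v.2) =
    - det z x u + det z x v.
    by rewrite /det; ring.
  have -> : (x.2 - z.2) * ((line_point (m%:R *+ 2) x y).1 - x.1) +
    - (x.1 - z.1) * ((line_point (m%:R *+ 2) x y).2 - x.2) = m%:R * (- 2 * det x y z).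
    by rewrite /line_point /det /= -mulr_natl; ring.
  rewrite ltr_pM2l //.
  have := sumE u; have := sumE v.
  by case: Tu => -[]; case: Tv => -[]; lra.
- apply: (@area_packing C _ x _ (- (x.2 - z.2)) (x.1 - z.1) m cC mC mT TC Cx Ca).
  move=> u v [Tu _] [Tv _].
  have -> : - (x.2 - z.2) * (u.1 - v.1) + (x.1 - z.1) * (u.2 - v.2) =
    det z x u - det z x v.
    by rewrite /det; ring.
  have -> : - (x.2 - z.2) * ((line_point (m%:R *+ 2) x y).1 - x.1) +
    (x.1 - z.1) * ((line_point (m%:R *+ 2) x y).2 - x.2) = m%:R * (2 * det x y z).
    by rewrite /line_point /det /= -mulr_natl; ring.
  rewrite ltr_pM2l //.
  have := sumE u; have := sumE v.
  by case: Tu => -[]; case: Tv => -[]; lra.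
- have T0 u : triangle x y z u -> det z x u = 0.
    by have := sumE u => E; case=> -[]; lra.
  have n0 : (- (x.2 - z.2), x.1 - z.1) != (0, 0).
    apply: contra_neq zx => -[/eqP]; rewrite oppr_eq0 subr_eq0 => /eqP e2 /eqP.
    rewrite subr_eq0 => /eqP e1.
    by rewrite [z]surjective_pairing [x]surjective_pairing e1 e2.
  have [b Cb fb] := interior_off_line (- (x.2 - z.2) * x.1 + (x.1 - z.1) * x.2) iC n0.
  move: fb; rewrite neq_lt => /orP[] fb.
  + apply: (@area_packing C _ x b (x.2 - z.2) (- (x.1 - z.1)) m cC mC mT TC Cx Cb).
    move=> u v [/T0 Tu _] [/T0 Tv _].
    have -> : (x.2 - z.2) * (u.1 - v.1) + - (x.1 - z.1) * (u.2 - v.2) =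
    - det z x u + det z x v.
      by rewrite /det; ring.
    by rewrite Tu Tv; lra.
  + apply: (@area_packing C _ x b (- (x.2 - z.2)) (x.1 - z.1) m cC mC mT TC Cx Cb).
    move=> u v [/T0 Tu _] [/T0 Tv _].
    have -> : - (x.2 - z.2) * (u.1 - v.1) + (x.1 - z.1) * (u.2 - v.2) =
    det z x u - det z x v.
      by rewrite /det; ring.
    by rewrite Tu Tv; lra.
Qed.

(** The set on the left is the copy of [C] shrunk towards [x] by [1/r], which
stays inside [C] by convexity. *)
Lemma area_close C x r : convex_set C -> measurable C -> C x -> 1 <= r ->
  ((r ^+ 2)%:E * area ([set y | C (line_point r x y)] `&` C) = area C)%E.
Proof.
move=> cC mC Cx r1; have r0 : r != 0 by rewrite gt_eqF //; lra.
rewrite [in RHS](@area_homothety _ r ((1 - r) * x.1, (1 - r) * x.2)) //.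
congr (_ * area _)%E.
rewrite /homothety /line_point /=; apply/seteqP; split=> y /=.
  by move=> [h _]; rewrite addrC [X in (_, X)]addrC.
move=> h; split; first by rewrite addrC [X in (_, X)]addrC.
have := convex_segment cC Cx h (_ : 0 <= r^-1) (_ : r^-1 <= 1).
rewrite /line_point /=.
have -> : ((1 - r^-1) * x.1 + r^-1 * (r * y.1 + (1 - r) * x.1),
  (1 - r^-1) * x.2 + r^-1 * (r * y.2 + (1 - r) * x.2)) = y.
  by case: y {h} => y1 y2 /=; congr (_, _); field.
apply; first by rewrite invr_ge0; lra.
by rewrite invf_le1 //; lra.
Qed.

(** Here [y] is given and [x] varies; the set is again homothetic to [C], with
the negative ratio [(1 - r)^-1]. *)
Lemma area_close_rev C y r : measurable C -> 1 < r ->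
  (((1 - r) ^+ 2)%:E * area ([set x | C (line_point r x y)] `&` C) <= area C)%E.
Proof.
move=> mC r1; have r0 : 1 - r != 0 by rewrite lt_eqF //; lra.
rewrite [leRHS](@area_homothety _ (1 - r) (r * y.1, r * y.2)) //.
apply: lee_wpmul2l; first by rewrite lee_fin sqr_ge0.
have mH : measurable (homothety (1 - r) (r * y.1, r * y.2) @^-1` C).
  by apply: preimage_measurable => //; exact: measurable_homothety.
by apply: le_measure; rewrite ?inE //; exact: measurableI.
Qed.

Lemma set1_prod (p : R * R) : [set p] = [set p.1] `*` [set p.2].
Proof.
by case: p => p1 p2; apply/seteqP; split => [_ ->//|[u v] /= [-> ->]].
Qed.

Lemma measurable_set1_prod (p : R * R) : measurable [set p].
Proof. by rewrite set1_prod; apply: measurableX; exact: measurable_set1. Qed.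

Lemma area_set1 (p : R * R) : area [set p] = 0%E.
Proof.
rewrite set1_prod.
have E := @product_measure1E _ _ _ _ R (@lebesgue_measure R) (@lebesgue_measure R)
  _ _ (measurable_set1 p.1) (measurable_set1 p.2).
apply: (etrans E); apply/eqP; rewrite mule_eq0; apply/orP; left; apply/eqP.
exact: (@lebesgue_measure_set1 R p.1).
Qed.

Lemma measurable_close d (T : measurableType d) C r (x y : T -> R * R) :
  measurable C -> measurable_fun setT x -> measurable_fun setT y ->
  measurable [set t | C (line_point r (x t) (y t))].
Proof.
move=> mC /measurable_coordinates[? ?] /measurable_coordinates[? ?].
apply: (preimage_measurable (f := fun t => line_point r (x t) (y t))) => //.
by apply: measurable_fun_pair; apply: measurable_funD;
  apply: measurable_funM => //; exact: measurable_cst.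
Qed.

End Geometry.

(** * Revealing one point last *)

Section Freezing.
Context (R : realType) d (T : measurableType d) (P : probability T R).
Context d1 (T1 : measurableType d1) d2 (T2 : measurableType d2).
Variables (Y : {mfun T >-> T1}) (X : {mfun T >-> T2}).
Hypothesis indYX : forall A B, measurable A -> measurable B ->
  (P (Y @^-1` A `&` X @^-1` B) = P (Y @^-1` A) * P (X @^-1` B))%E.

Local Open Scope ereal_scope.

Lemma independent_pair_law (E : set (T1 * T2)) : measurable E ->
  P [set w | E (Y w, X w)] = \int[distribution P Y]_y distribution P X (xsection E y).
Proof.
move=> mE.
have mp : measurable_fun setT (fun w => (Y w, X w)).
  by apply: measurable_fun_pair; exact: measurable_funPT.
have := @product_measure_unique _ _ _ _ R (distribution P Y) (distribution P X)
  (image_measure P mp).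
by move=> /(_ (fun A B mA mB => indYX mA mB) E mE) /esym.
Qed.

(** Integrate over [Y] the conditional probability of [E], which vanishes outside
[A]. *)
Lemma independent_pair_le (E : set (T1 * T2)) (A : set T1) (c : R) :
  measurable E -> measurable A -> (0 <= c)%R -> (forall y u, E (y, u) -> A y) ->
  (forall y, A y -> distribution P X (xsection E y) <= c%:E) ->
  P [set w | E (Y w, X w)] <= c%:E * P (Y @^-1` A).
Proof.
move=> mE mA c0 EA hE; rewrite independent_pair_law //.
have -> : P (Y @^-1` A) = \int[distribution P Y]_y (\1_A y)%:E.
  by rewrite integral_indic // setIT.
rewrite -ge0_integralZl //; last first.
- by apply/measurable_EFinP; exact: measurable_indic.
apply: ge0_le_integral => //.
- exact: measurable_fun_xsection.
- apply: emeasurable_funM; first exact: measurable_cst.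
  by apply/measurable_EFinP; exact: measurable_indic.
- move=> y _; rewrite indicE; have [Ay|Ay] := pselect (A y).
    by rewrite mem_set // mule1; exact: hE.
  rewrite memNset // (_ : xsection E y = set0) ?measure0 ?mule0 //.
  by apply/seteqP; split => // u; rewrite /xsection /= inE => /EA.
Qed.

Lemma independent_pair_eq (E : set (T1 * T2)) (A : set T1) (c : R) :
  measurable E -> measurable A -> (0 <= c)%R -> (forall y u, E (y, u) -> A y) ->
  (forall y, A y -> distribution P X (xsection E y) = c%:E) ->
  P [set w | E (Y w, X w)] = c%:E * P (Y @^-1` A).
Proof.
move=> mE mA c0 EA hE; rewrite independent_pair_law //.
have -> : P (Y @^-1` A) = \int[distribution P Y]_y (\1_A y)%:E.
  by rewrite integral_indic // setIT.
rewrite -ge0_integralZl //; last first.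
- by apply/measurable_EFinP; exact: measurable_indic.
apply: eq_integral => y _; rewrite indicE; have [Ay|Ay] := pselect (A y).
  by rewrite mem_set // mule1; exact: hE.
rewrite memNset // (_ : xsection E y = set0) ?measure0 ?mule0 //.
by apply/seteqP; split => // u; rewrite /xsection /= inE => /EA.
Qed.
End Freezing.

Section Others.
Context (R : realType) d (T : measurableType d) (P : probability T R).
Context d' (T' : measurableType d') (I : finType) (X : I -> {RV P >-> T'}).
Hypothesis indX : mutually_independent X.

(** A pi-system that generates the sigma-algebra of all the [X i] with [i != l]. *)
Definition others_cylinders (l : I) : set (set T) :=
  [set F | exists2 A : I -> set T', forall i, measurable (A i) &
     F = \bigcap_(i in [set i | i != l]) (X i @^-1` A i)].

(** The sample space with this coarser sigma-algebra.  Its identity map plays the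
role of the tuple of all [X i] with [i != l], which avoids finite products of
spaces. *)
Definition others (l : I) := g_sigma_algebraType (others_cylinders l).

Lemma measurable_RV i (B : set T') : measurable B -> measurable (X i @^-1` B).
Proof. by move=> mB; apply: preimage_measurable => //; exact: measurable_funPT. Qed.

Lemma others_cylinders_measurable l : others_cylinders l `<=` measurable.
Proof.
move=> _ [A mA ->]; apply: fin_bigcap_measurable; first exact: finite_finset.
by move=> i _; exact: measurable_RV.
Qed.

Lemma others_measurable l (F : set T) : measurable (F : set (others l)) -> measurable F.
Proof.
apply: smallest_sub; last exact: others_cylinders_measurable.
exact: sigma_algebra_measurable.
Qed.

Lemma measurable_others l i : i != l ->
  measurable_fun setT (X i : others l -> T').
Proof.
move=> il _ B mB; rewrite setTI; apply: sub_sigma_algebra.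
exists (fun j => if j == i then B else setT); first by move=> j; case: ifP.
apply/seteqP; split=> w /=.
  by move=> Bw j _; case: eqP => [->//|].
move=> /(_ i); by rewrite eqxx; apply.
Qed.

(** By Dynkin's theorem the product rule extends from the cylinders, where it is
the mutual independence of the family, to the sigma-algebra they generate. *)
Lemma others_independent l (F : set T) (B : set T') :
  measurable (F : set (others l)) -> measurable B ->
  (P (F `&` X l @^-1` B) = P F * P (X l @^-1` B))%E.
Proof.
move=> mF mB; have mXB := measurable_RV l mB.
apply: (@dynkin_induction _ (others l) (others_cylinders l)
  (fun F => P (F `&` X l @^-1` B) = P F * P (X l @^-1` B))%E) mF => //.
- move=> _ _ [A mA ->] [A' mA' ->]; exists (fun i => A i `&` A' i).
    by move=> i; exact: measurableI.
  rewrite -bigcapI; apply: eq_bigcapr => i _; exact: preimage_setI.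
- by rewrite setTI probability_setT mul1e.
- move=> _ [A mA ->].
  pose A2 i := if i == l then B else A i.
  have mA2 i : measurable (A2 i) by rewrite /A2; case: ifP.
  have A2l : A2 l = B by rewrite /A2 eqxx.
  have A2n i : i != l -> A2 i = A i by rewrite /A2 => /negbTE ->.
  have := indX [set: I]%SET mA2; rewrite (bigD1 l) ?inE //= A2l.
  have -> : \bigcap_(i in [set` [set: I]%SET]) (X i @^-1` A2 i) =
     \bigcap_(i in [set i | i != l]) (X i @^-1` A i) `&` X l @^-1` B.
    apply/seteqP; split=> w.
      move=> h; split; last by rewrite -A2l; apply: (h l); rewrite /= inE.
      by move=> i /= /A2n <-; apply: (h i); rewrite /= inE.
    move=> [h hl] i _; have [->|il] := eqVneq i l; first by rewrite A2l.
    by rewrite A2n //; exact: h.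
  move=> ->; rewrite muleC; congr (_ * _)%E.
  have -> : \bigcap_(i in [set i | i != l]) (X i @^-1` A i) =
     \bigcap_(i in [set` [set i | i != l]%SET]) (X i @^-1` A i).
    by apply/seteqP; split=> w h i /= il; apply: (h i); rewrite /= inE in il *.
  rewrite (indX _ mA); apply: eq_big => i; first by rewrite !inE.
  by rewrite !inE => /= il; rewrite A2n.
- move=> S /others_measurable mS hS.
  have -> : ~` S `&` X l @^-1` B = X l @^-1` B `\` S by rewrite setDE setIC.
  rewrite measureD //; last by rewrite (le_lt_trans (probability_le1 _ _)) ?ltry.
  rewrite setIC; apply: etrans; first by apply: congr1; apply: congr1; exact: hS.
  rewrite probability_setC // muleBl ?mul1e //.
  exact: fin_num_measure.
- move=> F' mF' tF' hF'.
  have mF'2 n : d.-measurable (F' n) by exact: (@others_measurable l (F' n) (mF' n)).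
  have E1 := @measure_bigcup _ _ _ P setT F' (fun i _ => mF'2 i) tF'.
  have E2 := @measure_bigcup _ _ _ P setT (fun i => F' i `&` X l @^-1` B)
    (fun i _ => measurableI _ _ (mF'2 i) mXB) (trivIset_setIr tF').
  rewrite setI_bigcupl; apply: (etrans E2).
  apply: etrans; last by apply: congr2; [exact: esym E1|].
  rewrite (eq_eseriesr (fun n _ => hF' n)).
  rewrite -(fineK (fin_num_measure P _ mXB)) [RHS]muleC -nneseriesZl //.
  by apply: eq_eseriesr => n _; rewrite muleC.
Qed.

(** The identity, with a type recording the change of sigma-algebra. *)
Definition id_others l : T -> others l := id.
Lemma measurable_id_others l : measurable_fun setT (id_others l).
Proof. by move=> _ B mB; rewrite setTI; exact: (@others_measurable l B mB). Qed.

Definition others_mfun l : {mfun T >-> others l} :=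
  mfun_Sub (mem_set (@measurable_id_others l)).

Lemma freeze_le l (E : set (T * T')) (A : set T) (c : R) :
  measurable (E : set (others l * T')) -> measurable (A : set (others l)) -> (0 <= c)%R ->
  (forall y u, E (y, u) -> A y) ->
  (forall y, A y -> (distribution P (X l) (xsection E y) <= c%:E)%E) ->
  (P [set w | E (w, X l w)] <= c%:E * P A)%E.
Proof.
move=> mE mA c0 EA hE.
exact: (@independent_pair_le R d T P _ (others l) _ T' (others_mfun l) (X l)
  (@others_independent l) E A c mE mA c0 EA hE).
Qed.

Lemma freeze_eq l (E : set (T * T')) (A : set T) (c : R) :
  measurable (E : set (others l * T')) -> measurable (A : set (others l)) -> (0 <= c)%R ->
  (forall y u, E (y, u) -> A y) ->
  (forall y, A y -> (distribution P (X l) (xsection E y) = c%:E)%E) ->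
  (P [set w | E (w, X l w)] = c%:E * P A)%E.
Proof.
move=> mE mA c0 EA hE.
exact: (@independent_pair_eq R d T P _ (others l) _ T' (others_mfun l) (X l)
  (@others_independent l) E A c mE mA c0 EA hE).
Qed.
End Others.

(** * Probabilities of the elementary events *)

Section Uniform.
Context (R : realType) d (T : measurableType d) (P : probability T R).
Variables (C : set (R * R)) (n : nat) (xi : 'I_n -> {RV P >-> (R * R)%type}).
Hypotheses (mC : measurable C) (cC : convex_set C) (iC : C° !=set0).
Hypothesis indX : mutually_independent xi.
Hypothesis unif : forall i, uniformly_distributed_on C (xi i).

(** Otherwise the whole space would not get probability one, because the
quotients [0 / 0] and [+oo / +oo] of extended reals are [0]. *)
Lemma area_fin_pos : 'I_n -> exists2 a : R, 0 < a & area C = a%:E.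
Proof.
move=> i; have := @unif i setT measurableT.
rewrite /distribution /pushforward preimage_setT probability_setT setTI.
have := area_ge0 C.
case: (area C) => [a||] //=; last by rewrite invey mule0 => _ /eqP; rewrite eqe oner_eq0.
rewrite lee_fin le_eqVlt => /orP[/eqP <-|a0 _]; last by exists a.
by rewrite mul0e => /eqP; rewrite eqe oner_eq0.
Qed.

Lemma law_le i (A : set (R * R)) (s t : R) : measurable A -> 0 < s ->
  (s%:E * area (A `&` C) <= t%:E * area C)%E ->
  (distribution P (xi i) A <= (t / s)%:E)%E.
Proof.
move=> mA s0; rewrite unif //; have [a a0 ->] := area_fin_pos i.
have := area_ge0 (A `&` C).
rewrite inver (gt_eqF a0).
case: (area (A `&` C)) => [b||] //=; last by rewrite mulry gtr0_sg // mul1e leye_eq.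
rewrite lee_fin => b0; rewrite -!EFinM !lee_fin => h.
by rewrite ler_pdivrMr // mulrAC ler_pdivlMr // mulrC.
Qed.

Lemma law_eq i (A : set (R * R)) (s t : R) : measurable A -> 0 < s ->
  (s%:E * area (A `&` C) = t%:E * area C)%E ->
  (distribution P (xi i) A = (t / s)%:E)%E.
Proof.
move=> mA s0; rewrite unif //; have [a a0 ->] := area_fin_pos i.
have := area_ge0 (A `&` C).
rewrite inver (gt_eqF a0).
case: (area (A `&` C)) => [b||] //=; last by rewrite mulry gtr0_sg // mul1e.
rewrite lee_fin => b0; rewrite -!EFinM => -[h]; congr EFin.
by apply/eqP; rewrite eqr_div ?(gt_eqF a0) ?(gt_eqF s0) // mulrC h.
Qed.

Lemma law_supp i : P (xi i @^-1` C) = 1%E.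
Proof.
have := @law_eq i C 1 1 mC ltr01; rewrite setIid divr1 => /(_ erefl).
by [].
Qed.

Variable r : R.
Hypothesis r2 : 2 <= r.

Let sqr_pos (t : R) : 0 < t -> 0 < t ^+ 2. Proof. by move=> t0; exact: exprn_gt0. Qed.
Let r_gt0 : 0 < r. Proof. by have := r2; lra. Qed.
Let r1_gt0 : 0 < r - 1. Proof. by have := r2; lra. Qed.

(** As [line_point r x y] is [x + r (y - x)], the condition says that [xi j] lies
in the copy of [C] shrunk towards [xi i] by the factor [1/r]. *)
Definition close_event i j : set T :=
  [set w | C (xi i w) /\ C (line_point r (xi i w) (xi j w))].

Lemma measurable_past l i :
  i != l -> measurable_fun setT (fun w : others xi l => xi i w).
Proof. exact: measurable_others. Qed.

Lemma measurable_past_fst l i : i != l ->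
  measurable_fun setT (fun p : others xi l * (R * R) => xi i p.1).
Proof.
by move=> il; apply: (measurableT_comp (measurable_past il)); exact: measurable_fst.
Qed.

Lemma measurable_close_pair d' (T0 : measurableType d') (x y : T0 -> R * R) :
  measurable_fun setT x -> measurable_fun setT y ->
  measurable [set t | C (x t) /\ C (line_point r (x t) (y t))].
Proof.
move=> mx my; apply: (@measurableI _ _ [set t | C (x t)]).
  exact: preimage_measurable.
exact: measurable_close.
Qed.

Lemma RV_measurable i : measurable_fun setT (xi i : T -> R * R).
Proof. exact: measurable_funPT. Qed.

Lemma measurable_close_event i j : measurable (close_event i j).
Proof. by apply: measurable_close_pair; exact: RV_measurable. Qed.

(** Reveal [xi j] last. *)
Lemma prob_close i j : i != j -> P (close_event i j) = ((r ^+ 2)^-1)%:E.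
Proof.
move=> ij; have r20 : 0 < r ^+ 2 := sqr_pos r_gt0.
have := @freeze_eq R d T P _ _ _ xi indX j
  [set p | C (xi i p.1) /\ C (line_point r (xi i p.1) p.2)] (xi i @^-1` C) (1 / r ^+ 2).
rewrite law_supp mule1 div1r; apply.
- by apply: measurable_close_pair; [exact: measurable_past_fst|exact: measurable_snd].
- by apply: preimage_measurable => //; exact: measurable_past.
- by rewrite invr_ge0 ltW.
- by move=> y u [].
- move=> y Cy; rewrite -div1r; apply: law_eq => //.
    apply: measurable_xsection.
    by apply: (@measurable_close_pair _ (T * (R * R))%type); [
      apply: (measurableT_comp (RV_measurable i)); exact: measurable_fst|
      exact: measurable_snd].
  rewrite mul1e -[RHS](@area_close R C (xi i y) r cC mC Cy); last by have := r2; lra.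
  congr (_ * area _)%E; apply/seteqP; split => u /=.
    by rewrite /xsection /= inE /= => -[[_ h] Cu].
  by rewrite /xsection /= inE /= => -[h Cu].
Qed.

(** Reveal [xi l] last: the first pair is known by then, and the conditional
probability of the second is [r^-2], which is bounded here by [(r - 1)^-2] for
uniformity with the next lemma. *)
Lemma prob_close_then i j k l : k != l -> l != i -> l != j -> i != j ->
  (P (close_event i j `&` close_event k l) <= (((r - 1) ^+ 2)^-1 * (r ^+ 2)^-1)%:E)%E.
Proof.
move=> kl li lj ij; have r20 : 0 < r ^+ 2 := sqr_pos r_gt0.
have r120 : 0 < (r - 1) ^+ 2 := sqr_pos r1_gt0.
have := @freeze_le R d T P _ _ _ xi indX l
  [set p | (C (xi i p.1) /\ C (line_point r (xi i p.1) (xi j p.1))) /\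
   (C (xi k p.1) /\ C (line_point r (xi k p.1) p.2))]
  (close_event i j) (((r - 1) ^+ 2)^-1).
rewrite prob_close // -EFinM; apply.
- apply: (@measurableI _ _ [set p : others xi l * (R * R) |
      C (xi i p.1) /\ C (line_point r (xi i p.1) (xi j p.1))]);
    apply: measurable_close_pair; try exact: measurable_snd;
    by apply: measurable_past_fst; rewrite // eq_sym.
- by apply: measurable_close_pair; apply: measurable_past; rewrite // eq_sym.
- by rewrite invr_ge0 ltW.
- by move=> y u [].
- move=> y [Ci Cij]; have [Ck|nCk] := pselect (C (xi k y)); last first.
    rewrite (_ : xsection _ _ = set0) ?measure0 ?lee_fin ?invr_ge0 ?(ltW r120) //.
    by apply/seteqP; split => // u; rewrite /xsection /= inE /= => -[_ []].
  have -> : xsection [set p | (C (xi i p.1) /\ C (line_point r (xi i p.1) (xi j p.1))) /\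
   (C (xi k p.1) /\ C (line_point r (xi k p.1) p.2))] y =
   [set u | C (line_point r (xi k y) u)].
    apply/seteqP; split => u; rewrite /xsection /= inE /=; tauto.
  apply: le_trans (_ : (1 / r ^+ 2)%:E <= _)%E.
    apply: law_le => //.
      by apply: measurable_close.
    by rewrite mul1e (@area_close R C (xi k y) r cC mC Ck) //; have := r2; lra.
  by rewrite div1r lee_fin lef_pV2 ?posrE // !expr2; have := r2; nra.
Qed.

(** Reveal [xi k] last; this settles the pairs [(k, l)] whose second point belongs
to the first pair. *)
Lemma prob_close_then_rev i j k l : k != l -> k != i -> k != j -> i != j ->
  (P (close_event i j `&` close_event k l) <= (((r - 1) ^+ 2)^-1 * (r ^+ 2)^-1)%:E)%E.
Proof.
move=> kl ki kj ij; have r20 : 0 < r ^+ 2 := sqr_pos r_gt0.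
have r120 : 0 < (r - 1) ^+ 2 := sqr_pos r1_gt0.
have lk : l != k by rewrite eq_sym.
have := @freeze_le R d T P _ _ _ xi indX k
  [set p | (C (xi i p.1) /\ C (line_point r (xi i p.1) (xi j p.1))) /\
   (C p.2 /\ C (line_point r p.2 (xi l p.1)))] (close_event i j) (((r - 1) ^+ 2)^-1).
rewrite prob_close // -EFinM; apply.
- apply: (@measurableI _ _ [set p : others xi k * (R * R) |
      C (xi i p.1) /\ C (line_point r (xi i p.1) (xi j p.1))]);
    apply: measurable_close_pair; try exact: measurable_snd;
    by apply: measurable_past_fst; rewrite // eq_sym.
- by apply: measurable_close_pair; apply: measurable_past; rewrite // eq_sym.
- by rewrite invr_ge0 ltW.
- by move=> y u [].
- move=> y [Ci Cij].
  have -> : xsection [set p | (C (xi i p.1) /\ C (line_point r (xi i p.1) (xi j p.1))) /\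
   (C p.2 /\ C (line_point r p.2 (xi l p.1)))] y =
   [set u | C (line_point r u (xi l y))] `&` C.
    apply/seteqP; split => u; rewrite /xsection /= inE /=; tauto.
  have mr : measurable [set u | C (line_point r u (xi l y))].
    by apply: measurable_close.
  rewrite -div1r; apply: law_le => //; first exact: measurableI.
  rewrite -setIA setIid mul1e -[(r - 1)]opprB sqrrN.
  by apply: area_close_rev => //; have := r2; lra.
Qed.

(** Reveal [xi j] last. *)
Lemma prob_coincide i j : i != j -> P [set w | xi i w = xi j w] = 0%E.
Proof.
move=> ij; apply/eqP; rewrite eq_le measure_ge0 andbT.
have := @freeze_le R d T P _ _ _ xi indX j [set p | xi i p.1 = p.2] setT 0.
rewrite mul0e; apply=> //.
- by apply: measurable_coincide; [exact: measurable_past_fst|exact: measurable_snd].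
- move=> y _; have -> : xsection [set p | xi i p.1 = p.2] y = [set xi i y].
    by apply/seteqP; split => u; rewrite /xsection /= inE /= => ->.
  have m1 : measurable [set xi i y] by exact: measurable_set1_prod.
  rewrite -[0](mul0r 1^-1); apply: law_le => //.
  rewrite mul1e mul0e -(area_set1 (xi i y)); apply: le_measure; rewrite ?inE //.
    exact: measurableI.
Qed.

(** Reveal [xi l] last. *)
Lemma prob_in_triangle m i j k l : (0 < m)%N -> r = m%:R *+ 2 -> i != j ->
  l != i -> l != j -> l != k ->
  (P [set w | close_event i j w /\ (C (xi k w) /\ xi k w <> xi i w) /\
     triangle (xi i w) (xi j w) (xi k w) (xi l w)] <= (4 / m%:R * (r ^+ 2)^-1)%:E)%E.
Proof.
move=> m0 rm ij li lj lk.
have il : i != l by rewrite eq_sym.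
have jl : j != l by rewrite eq_sym.
have kl : k != l by rewrite eq_sym.
have mR : 0 < m%:R :> R by rewrite ltr0n.
have c0 : 0 <= 4 / m%:R :> R by rewrite divr_ge0.
have rg : 0 < (r ^+ 2)^-1 by rewrite invr_gt0 sqr_pos.
pose thin (x y z : R * R) := (C x /\ C (line_point r x y)) /\ (C z /\ z <> x).
have m4 d' (T0 : measurableType d') (x y z : T0 -> R * R) :
    measurable_fun setT x -> measurable_fun setT y -> measurable_fun setT z ->
    measurable [set t | thin (x t) (y t) (z t)].
  move=> mx my mz.
  apply: (@measurableI _ _ [set t | C (x t) /\ C (line_point r (x t) (y t))]).
    exact: measurable_close_pair.
  apply: (@measurableI _ _ (z @^-1` C)); first exact: preimage_measurable.
  by apply: (@measurableC _ _ [set t | z t = x t]); exact: measurable_coincide.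
have := @freeze_le R d T P _ _ _ xi indX l
  [set p | thin (xi i p.1) (xi j p.1) (xi k p.1) /\
     triangle (xi i p.1) (xi j p.1) (xi k p.1) p.2]
  [set w | thin (xi i w) (xi j w) (xi k w)] (4 / m%:R).
move=> h; apply: (@le_trans _ _
  ((4 / m%:R)%:E * P [set w | thin (xi i w) (xi j w) (xi k w)])%E); last first.
  rewrite [leRHS]EFinM; apply: lee_wpmul2l; first by rewrite lee_fin.
  rewrite -(prob_close ij); apply: le_measure; rewrite ?inE //.
  - by apply: m4; exact: RV_measurable.
  - exact: measurable_close_event.
  - by move=> w [].
apply: le_trans (h _ _ _ _ _) => //.
- apply: le_measure; rewrite ?inE.
  + rewrite (_ : [set w | _] = [set w | thin (xi i w) (xi j w) (xi k w)] `&`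
      [set w | triangle (xi i w) (xi j w) (xi k w) (xi l w)]).
      by apply: measurableI; [apply: m4; exact: RV_measurable
        |apply: measurable_in_triangle; exact: RV_measurable].
    by apply/seteqP; split => w /=; rewrite /thin /close_event /=; tauto.
  + apply: measurableI; [apply: m4; exact: RV_measurable
        |apply: measurable_in_triangle; exact: RV_measurable].
  + by move=> w /=; rewrite /thin /close_event /=; tauto.
- apply: (@measurableI _ _ [set p : others xi l * (R * R) |
      thin (xi i p.1) (xi j p.1) (xi k p.1)]).
    by apply: m4; exact: measurable_past_fst.
  by apply: measurable_in_triangle; (exact: measurable_past_fst || exact: measurable_snd).
- by apply: m4; exact: measurable_past.
- by move=> y u [].
- move=> y [[Ci Cij] [Ck ki]].
  have -> : xsection [set p | thin (xi i p.1) (xi j p.1) (xi k p.1) /\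
     triangle (xi i p.1) (xi j p.1) (xi k p.1) p.2] y =
     triangle (xi i y) (xi j y) (xi k y).
    apply/seteqP; split => u; rewrite /xsection /= inE /=; first by case.
    by split.
  apply: law_le => //.
    exact: (@measurable_in_triangle _ _ _
      (fun=> xi i y) (fun=> xi j y) (fun=> xi k y) id).
  apply: area_thin_triangle => //; first exact/eqP.
  by rewrite -rm.
Qed.
End Uniform.

(** * Empty triangles on a common edge and the degree *)

Section Deterministic.
Variables (R : realType) (n : nat) (x : 'I_n -> R * R).
Hypothesis injx : injective x.
Let X := [fset x i | i : 'I_n]%fset.

Definition triangle_free i j k := forall l, l != i -> l != j -> l != k ->
  ~ triangle (x i) (x j) (x k) (x l).

Lemma empty_triangle_free i j k :
  triangle_free i j k -> empty_triangle X (x i) (x j) (x k).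
Proof.
move=> tf; apply/seteqP; split => u.
  move=> [/convex_hull_triangle hu /= /imfsetP[l _ /= ul]].
  have [li|li] := eqVneq l i; first by left; left; rewrite ul li.
  have [lj|lj] := eqVneq l j; first by left; right; rewrite ul lj.
  have [lk|lk] := eqVneq l k; first by right; rewrite ul lk.
  by case: (tf l li lj lk); rewrite -ul.
move=> h; split; first by apply: sub_gen_smallest.
have inX a : x a \in X by apply/imfsetP; exists a.
by case: h => [[->|->]|->] /=; exact: inX.
Qed.

Lemma card_le_degree i j (K : {set 'I_n}) : i != j ->
  (forall k, k \in K -> [/\ k != i, k != j & triangle_free i j k]) ->
  (#|K| <= degree X)%N.
Proof.
move=> ij hK.
have inX a : x a \in X by apply/imfsetP; exists a.
rewrite /degree.
apply: leq_trans (leq_bigmax_seq _ (inX i) isT).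
have xji : x j != x i by apply: contra_neq ij => /injx ->.
apply: leq_trans (leq_bigmax_seq _ (inX j) xji).
rewrite /pair_degree cardE -(size_map x); apply: uniq_leq_size.
  by rewrite map_inj_uniq ?enum_uniq.
move=> z /mapP[k]; rewrite mem_enum => /hK[ki kj tf] ->.
rewrite !inE /=; apply/and3P; split; first exact: inX.
  by rewrite !(inj_eq injx) negb_or ki kj.
by apply/asboolP; exact: empty_triangle_free.
Qed.
End Deterministic.

(** * Integrals and finite unions *)

Section Integral.
Local Open Scope ereal_scope.
Context (R : realType) d (T : measurableType d) (mu : {measure set T -> \bar R}).

(** The integral of a nonnegative function is a supremum over the simple functions
below it, hence monotone even on functions that are not known to be measurable,
such as the degree of a random set. *)
Lemma ge0_le_integral_nonmeasurable (f g : T -> \bar R) :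
  (forall x, 0 <= f x) -> (forall x, f x <= g x) -> \int[mu]_x f x <= \int[mu]_x g x.
Proof.
move=> f0 fg; have g0 x : 0 <= g x by exact: le_trans (f0 x) (fg x).
rewrite !ge0_integralTE //; apply: ereal_sup_le => _ [h hf <-]; exists h => // x.
exact: le_trans (hf x) (fg x).
Qed.

Lemma measure_bigsetU_le (I : finType) (p : pred I) (F : I -> set T) (c : \bar R) :
  0 <= c -> (forall i, p i -> measurable (F i)) -> (forall i, p i -> mu (F i) <= c) ->
  mu (\big[setU/set0]_(i | p i) F i) <= #|I|%:R%:E * c.
Proof.
move=> c0 mF hF.
have [_ h] : measurable (\big[setU/set0]_(i | p i) F i) /\
   mu (\big[setU/set0]_(i | p i) F i) <= \sum_(i | p i) c.
  elim/big_ind2: _ => [|A a B b [mA hA] [mB hB]|i pi].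
  - by rewrite measure0.
  - split; first exact: measurableU.
    by apply: le_trans (measureU2 _ mA mB) _; exact: leeD.
  - by split; [exact: mF|exact: hF].
apply: le_trans h _.
have -> : \sum_(i | p i) c = #|p|%:R%:E * c by rewrite mule_natl sumr_const.
rewrite lee_wpmul2r // lee_fin ler_nat.
exact: max_card.
Qed.

Lemma bigsetU_sup (I : finType) (p : pred I) (F : I -> set T) i :
  p i -> F i `<=` \big[setU/set0]_(i | p i) F i.
Proof. by move=> pi w Fw; rewrite (bigD1 i) //=; left. Qed.
End Integral.

(** * A single close pair has linear degree *)

Section Good.
Context (R : realType) d (T : measurableType d) (P : probability T R).
Variables (C : set (R * R)) (n : nat) (xi : 'I_n -> {RV P >-> (R * R)%type}).
Hypotheses (mC : measurable C) (cC : convex_set C) (iC : C° !=set0).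
Hypothesis indX : mutually_independent xi.
Hypothesis unif : forall i, uniformly_distributed_on C (xi i).
Hypothesis n0 : (0 < n)%N.

(* With [r = 2 m = 16 n] the bad events of the union bound have total
   probability at most [1/2 + 1/4] relative to that of a close pair. *)
Let m := (8 * n)%N.
Let r : R := m%:R *+ 2.
Let close i j := close_event C xi r i j.

Definition intruder i j k l : set T :=
  [set w | close i j w /\ (C (xi k w) /\ xi k w <> xi i w) /\
     triangle (xi i w) (xi j w) (xi k w) (xi l w)].

(** What spoils the pair [(i, j)] and its third point [k]: a fourth point in the
triangle, another close pair, and the null events that two points coincide or
that a point lies outside [C]. *)
Definition exceptional i j k : set T :=
  \big[setU/set0]_(l | [&& l != i, l != j & l != k]) intruder i j k l `|`
  \big[setU/set0]_(q : 'I_n * 'I_n | (q.1 < q.2)%N && (q != (i, j)))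
     (close i j `&` close q.1 q.2) `|`
  \big[setU/set0]_(q : 'I_n * 'I_n | q.1 != q.2) [set w | xi q.1 w = xi q.2 w] `|`
  \big[setU/set0]_(a : 'I_n | true) ~` (xi a @^-1` C).

Definition good i j k : set T := close i j `\` exceptional i j k.

Lemma good_injective i j k w : good i j k w -> injective (fun a => xi a w).
Proof.
move=> [_ nE] a b ab; apply: contrapT => /eqP anb; apply: nE; left; right.
exact: (bigsetU_sup (i := (a, b)) (F := fun q => [set w | xi q.1 w = xi q.2 w])).
Qed.

Lemma good_unique i j k w (q : 'I_n * 'I_n) :
  good i j k w -> (q.1 < q.2)%N -> close q.1 q.2 w -> q = (i, j).
Proof.
move=> [cij nE] qlt cq; apply: contrapT => /eqP qij; apply: nE; left; left; right.
apply: (bigsetU_sup (i := q) (F := fun q => close i j `&` close q.1 q.2)) => //.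
by rewrite qlt.
Qed.

Lemma good_triangle_free i j k w : k != i ->
  good i j k w -> triangle_free (fun a => xi a w) i j k.
Proof.
move=> ki gw l li lj lk tri; have [cij nE] := gw; apply: nE; left; left; left.
apply: (bigsetU_sup (i := l) (F := intruder i j k)); first by rewrite li lj lk.
split => //; split => //; split.
  2: by move=> /(good_injective gw) /eqP; rewrite (negbTE ki).
apply: contrapT => nC; case: gw => _; apply; right.
exact: (bigsetU_sup (i := k) (F := fun a => ~` (xi a @^-1` C))).
Qed.

Let mclose i j : measurable (close i j).
Proof. exact: measurable_close_event. Qed.

Lemma measurable_intruder i j k l : measurable (intruder i j k l).
Proof.
have mx a := @RV_measurable R d T P n xi a.
apply: measurableI; first exact: mclose.
apply: (@measurableI _ _ [set w | C (xi k w) /\ xi k w <> xi i w]); last first.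
  exact: measurable_in_triangle.
apply: (@measurableI _ _ (xi k @^-1` C)); first exact: preimage_measurable.
by apply: (@measurableC _ _ [set w | xi k w = xi i w]); exact: measurable_coincide.
Qed.

Lemma measurable_exceptional i j k : measurable (exceptional i j k).
Proof.
have mx a := @RV_measurable R d T P n xi a.
apply: measurableU; [apply: measurableU; [apply: measurableU|]|];
  apply: bigsetU_measurable => q _.
- exact: measurable_intruder.
- exact: measurableI.
- exact: measurable_coincide.
- by apply: measurableC; exact: preimage_measurable.
Qed.

Lemma measurable_good i j k : measurable (good i j k).
Proof. by apply: measurableD => //; exact: measurable_exceptional. Qed.

(** Of the factor [3/4], [1/2] comes from the [n] possible intruders, each with
conditional probability [4/m = 1 / (2 n)], and [1/4] from the at most [n^2] other
close pairs. *)
Lemma prob_exceptional (i j k : 'I_n) : (i < j)%N -> k != i -> k != j ->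
  (P (exceptional i j k) <= (3 / 4 * (r ^+ 2)^-1)%:E)%E.
Proof.
move=> ij ki kj; have nij : i != j by rewrite neq_ltn ij.
have mx a := @RV_measurable R d T P n xi a.
have nR : 1 <= n%:R :> R by rewrite (ler_nat _ 1).
have rE : r = 16 * n%:R by rewrite /r /m natrM; ring.
have r2 : 2 <= r by rewrite rE; lra.
have rg : 0 < (r ^+ 2)^-1 by rewrite invr_gt0 exprn_gt0 //; lra.
have m0 : (0 < m)%N by rewrite /m muln_gt0.
have b1 : (P (\big[setU/set0]_(l | [&& l != i, l != j & l != k]) intruder i j k l)
   <= #|'I_n|%:R%:E * (4 / m%:R * (r ^+ 2)^-1)%:E)%E.
  apply: measure_bigsetU_le.
  - by rewrite lee_fin mulr_ge0 ?(ltW rg) // divr_ge0.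
  - by move=> l _; exact: measurable_intruder.
  - by move=> l /and3P[li lj lk]; exact: prob_in_triangle.
have b2 : (P (\big[setU/set0]_(q : 'I_n * 'I_n | (q.1 < q.2)%N && (q != (i, j)))
     (close i j `&` close q.1 q.2)) <=
   #|{: 'I_n * 'I_n}|%:R%:E * (((r - 1) ^+ 2)^-1 * (r ^+ 2)^-1)%:E)%E.
  apply: measure_bigsetU_le.
  - by rewrite lee_fin mulr_ge0 ?(ltW rg) // invr_ge0 exprn_ge0 //; lra.
  - by move=> q _; exact: measurableI.
  - move=> [a b] /= /andP[ab].
    have nab : a != b by rewrite neq_ltn ab.
    have [bi|bi] := eqVneq b i.
      move=> _; apply: prob_close_then_rev => //.
        by rewrite -bi.
      by rewrite neq_ltn; apply/orP; left; rewrite (ltn_trans ab) // bi.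
    have [bj|bj] := eqVneq b j.
      have aj : a != j by rewrite -bj.
      have [->|ai] := eqVneq a i; first by rewrite bj eqxx.
      by move=> _; exact: prob_close_then_rev.
    by move=> _; exact: prob_close_then.
have b3 : (P (\big[setU/set0]_(q : 'I_n * 'I_n | q.1 != q.2)
     [set w | xi q.1 w = xi q.2 w]) <=
   #|{: 'I_n * 'I_n}|%:R%:E * 0)%E.
  apply: measure_bigsetU_le => //.
  - by move=> q _; exact: measurable_coincide.
  - move=> q nq; rewrite le_eqVlt; apply/orP; left; apply/eqP.
    exact: (prob_coincide mC indX unif nq).
have b4 : (P (\big[setU/set0]_(a : 'I_n | true) ~` (xi a @^-1` C)) <=
   #|'I_n|%:R%:E * 0)%E.
  apply: measure_bigsetU_le => //.
  - by move=> q _; apply: measurableC; exact: preimage_measurable.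
  - move=> a _; have mXC : measurable (xi a @^-1` C) by exact: preimage_measurable.
    have := probability_setC P mXC.
    rewrite (law_supp mC unif) subee // => E.
    by rewrite le_eqVlt; apply/orP; left; apply/eqP; exact: E.
rewrite mule0 in b3; rewrite mule0 in b4.
rewrite /exceptional.
have mA1 : measurable (\big[setU/set0]_(l | [&& l != i, l != j & l != k])
     intruder i j k l).
  by apply: bigsetU_measurable => q _; exact: measurable_intruder.
have mA2 : measurable (\big[setU/set0]_(q : 'I_n * 'I_n | (q.1 < q.2)%N && (q != (i, j)))
     (close i j `&` close q.1 q.2)).
  by apply: bigsetU_measurable => q _; exact: measurableI.
have mA3 : measurable (\big[setU/set0]_(q : 'I_n * 'I_n | q.1 != q.2)
     [set w | xi q.1 w = xi q.2 w]).
  by apply: bigsetU_measurable => q _; exact: measurable_coincide.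
have mA4 : measurable (\big[setU/set0]_(a : 'I_n | true) ~` (xi a @^-1` C)).
  by apply: bigsetU_measurable => q _; apply: measurableC; exact: preimage_measurable.
apply: le_trans (measureU2 _ _ mA4) _.
  by apply: measurableU => //; exact: measurableU.
apply: le_trans (leeD _ b4) _.
  apply: le_trans (measureU2 _ _ mA3) _; first exact: measurableU.
  apply: leeD b3; apply: le_trans (measureU2 _ mA1 mA2) _; exact: leeD b1 b2.
rewrite !adde0 card_prod card_ord -!EFinM -EFinD lee_fin.
have nn : (n%:R : R) != 0 by rewrite gt_eqF //; lra.
rewrite mulrA [X in _ + X]mulrA -mulrDl ler_wpM2r ?(ltW rg) //.
have -> : n%:R * (4 / m%:R) = 1 / 2 :> R by rewrite /m natrM; field.
have : (n * n)%:R * ((r - 1) ^+ 2)^-1 <= 1 / 4.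
  rewrite ler_pdivrMr; last by apply: exprn_gt0; rewrite rE; lra.
  by rewrite rE natrM; nra.
lra.
Qed.

Lemma prob_good (i j k : 'I_n) : (i < j)%N -> k != i -> k != j ->
  ((1 / 4 * (r ^+ 2)^-1)%:E <= P (good i j k))%E.
Proof.
move=> ij ki kj; have nij : i != j by rewrite neq_ltn ij.
have nR : 1 <= n%:R :> R by rewrite (ler_nat _ 1).
have rE : r = 16 * n%:R by rewrite /r /m natrM; ring.
have r2 : 2 <= r by rewrite rE; lra.
have mE := measurable_exceptional i j k.
rewrite /good measureD //; last by rewrite (le_lt_trans (probability_le1 _ _)) ?ltry.
have pc : (P (close i j) = ((r ^+ 2)^-1)%:E)%E := prob_close mC cC indX unif r2 nij.
have h : (P (close i j `&` exceptional i j k) <= (3 / 4 * (r ^+ 2)^-1)%:E)%E.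
  apply: le_trans (prob_exceptional ij ki kj).
  by apply: le_measure; rewrite ?inE //; exact: measurableI.
apply: le_trans (leeB (lexx _) h); rewrite [X in (X - _)%E]pc -EFinB lee_fin.
lra.
Qed.

Definition pairs : pred ('I_n * 'I_n) := fun p => (p.1 < p.2)%N.

(** All the triples whose good event occurs at [w] share the same pair, the only
close one, and their third points form empty triangles with it. *)
Lemma good_le_degree w :
  (\sum_(p | pairs p) \sum_(k | (k != p.1) && (k != p.2)) \1_(good p.1 p.2 k) w
    <= (degree (random_set xi w))%:R :> R).
Proof.
have [[[i j] /= [k [/andP[ij ki] g]]]|none] := pselect (exists p : 'I_n * 'I_n, exists k,
   (pairs p && (k != p.1)) /\ good p.1 p.2 k w); last first.
  rewrite big1 // => p pp; rewrite big1 // => k /andP[k1 k2].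
  rewrite indicE memNset // => g; apply: none; exists p, k; by rewrite pp k1.
rewrite (bigD1 (i, j)) //= [X in _ + X]big1 ?addr0; last first.
  move=> p /andP[pp pij]; rewrite big1 // => k' /andP[k1 k2].
  rewrite indicE memNset // => g'; move/eqP: pij; apply.
  have [cp _] := g'.
  exact: (good_unique g pp cp).
under eq_bigr do rewrite indicE.
rewrite -natr_sum ler_nat big_mkcond /=.
pose K := [set k' : 'I_n | [&& k' != i, k' != j & w \in good i j k']]%SET.
have -> : (\sum_(k' < n) (if (k' != i) && (k' != j)
    then (w \in good i j k' : nat) else 0) = #|K|)%N.
  rewrite -sum1_card [RHS]big_mkcond /=; apply: eq_bigr => k' _; rewrite inE.
  by case: (k' != i); case: (k' != j) => //=; case: (w \in _).
have nij : i != j by rewrite neq_ltn; apply/orP; left.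
apply: (@card_le_degree R n (fun a => xi a w) (good_injective g) i j K nij).
move=> k'; rewrite inE => /and3P[k1 k2 /set_mem g']; split => //.
exact: good_triangle_free g'.
Qed.

Lemma card_pairs : #|pairs| = 'C(n, 2).
Proof.
rewrite -triangular_sum big_mkord -sum1_card.
rewrite -(pair_big_dep xpredT (fun i j : 'I_n => (i < j)%N) (fun _ _ => 1%N)) /=.
rewrite (exchange_big_dep xpredT) //=; apply: eq_bigr => j _.
by rewrite -(big_ord_widen n (fun=> 1%N) (ltnW (ltn_ord j))) sum1_card card_ord.
Qed.

Lemma expected_degree_ge :
  ((('C(n, 2) * (n - 2))%N%:R * (1 / 4 * (r ^+ 2)^-1))%:E
     <= 'E_P[fun w => (degree (random_set xi w))%:R])%E.
Proof.
rewrite unlock.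
have mI i j k : measurable_fun setT (fun w => (\1_(good i j k) w : R)%:E).
  by apply/measurable_EFinP; exact: measurable_indic (measurable_good i j k).
pose ps := [seq p <- index_enum ('I_n * 'I_n)%type | pairs p].
pose ks (p : 'I_n * 'I_n) := [seq k <- index_enum 'I_n | (k != p.1) && (k != p.2)].
pose good_sum w : \bar R :=
  (\sum_(p <- ps) \sum_(k <- ks p) (\1_(good p.1 p.2 k) w)%:E)%E.
have good_sumE w : good_sum w = (\sum_(p | pairs p)
    \sum_(k | (k != p.1) && (k != p.2)) \1_(good p.1 p.2 k) w : R)%:E.
  rewrite /good_sum big_filter -sumEFin; apply: eq_bigr => p _.
  by rewrite big_filter sumEFin.
apply: le_trans (ge0_le_integral_nonmeasurable P (f := good_sum) _ _); first last.
- by move=> w; rewrite good_sumE lee_fin good_le_degree.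
- by move=> w; rewrite good_sumE lee_fin sumr_ge0 // => p _; rewrite sumr_ge0.
rewrite ge0_integral_sum //; first last.
- by move=> p w _; apply: sume_ge0.
- by move=> p; apply: emeasurable_sum => k.
have lb (p : 'I_n * 'I_n) : pairs p -> (((n - 2)%N%:R * (1 / 4 * (r ^+ 2)^-1))%:E <=
   \int[P]_w (\sum_(k <- ks p) (\1_(good p.1 p.2 k) w)%:E))%E.
  move=> pp; rewrite ge0_integral_sum // big_filter.
  apply: le_trans (lee_sum (f := fun _ => (1 / 4 * (r ^+ 2)^-1)%:E) _ _); last first.
    move=> k /andP[k1 k2]; rewrite integral_indic ?setIT //; last exact: measurable_good.
    exact: prob_good.
  rewrite sumEFin lee_fin sumr_const -[leRHS]mulr_natl.
  have -> : #|[pred k | (k != p.1) && (k != p.2)]| = (n - 2)%N; last exact: lexx.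
  have nij : p.1 != p.2 by rewrite neq_ltn; apply/orP; left.
  have := cardC [pred k | (k == p.1) || (k == p.2)].
  have -> : #|[pred k | (k == p.1) || (k == p.2)]| = 2 by rewrite card2 nij.
  rewrite card_ord => nE.
  have -> : (n - 2)%N = #|predC [pred k | (k == p.1) || (k == p.2)]|.
    by rewrite -[in LHS]nE addKn.
  by apply: eq_card => k; rewrite !inE negb_or.
rewrite big_filter.
apply: le_trans (lee_sum
  (f := fun _ => ((n - 2)%N%:R * (1 / 4 * (r ^+ 2)^-1))%:E) _ _); last first.
  by move=> p pp; exact: lb.
by rewrite sumEFin lee_fin sumr_const -[leRHS]mulr_natl natrM -[leLHS]mulrA -card_pairs.
Qed.
End Good.

(** * The lower bound for the expectation *)

(** The constant is [1/9216], attained at [n = 3]: there [(n - 1) (n - 2)] equals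
[2 n^2 / 9]. *)
Lemma bin_linear_lower_bound (R : realFieldType) : exists2 c0 : R, 0 < c0 &
  forall n : nat, (3 <= n)%N ->
  c0 * n%:R <= ('C(n, 2) * (n - 2))%N%:R * (1 / 4 * (((8 * n)%N%:R *+ 2) ^+ 2)^-1) :> R.
Proof.
exists 9216^-1; first by lra.
move=> n n3; have hn : 3 <= n%:R :> R by rewrite ler_nat.
have n0 : n%:R != 0 :> R by rewrite gt_eqF //; lra.
have -> : ('C(n, 2) * (n - 2))%N%:R = n%:R * (n%:R - 1) / 2 * (n%:R - 2) :> R.
  rewrite natrM natrB; last exact: leq_trans n3.
  congr (_ * _); apply: (canRL (mulfK _)); first by rewrite pnatr_eq0.
  rewrite -natrM mulnC -[2%N]/(2`!) mulnC bin_ffact ffactnSr ffactn1 natrM natrB //.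
  exact: leq_trans n3.
have -> : n%:R * (n%:R - 1) / 2 * (n%:R - 2) * (1 / 4 * (((8 * n)%N%:R *+ 2) ^+ 2)^-1)
  = (n%:R - 1) * (n%:R - 2) / (2048 * n%:R) :> R by rewrite natrM; field.
rewrite ler_pdivlMr; last by lra.
nra.
Qed.

Unset Implicit Arguments.

Theorem theorem1 (R : realType) :
  exists c : R, 0 < c /\
    forall C : set (R * R), compact C -> convex_set C -> C° !=set0 ->
    forall n : nat, (3 <= n)%N ->
    forall (d : measure_display) (T : measurableType d) (P : probability T R)
      (xi : 'I_n -> {RV P >-> (R * R)%type}),
      mutually_independent xi ->
      (forall i, uniformly_distributed_on C (xi i)) ->
      ((c * n%:R / ln n%:R)%:E
        <= 'E_P[fun w => (degree (random_set xi w))%:R])%E.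
Proof.
(* The expectation is at least [c0 * n]; the factor [ln 2] pays for [ln n >= ln 2]. *)
have ln2 : 0 < ln 2 :> R by rewrite ln_gt0 // ltr1n.
have [c0 c0_gt0 lin] := bin_linear_lower_bound R.
exists (c0 * ln 2); split; first exact: mulr_gt0.
move=> C cptC cC iC n n3 d T P xi indX unif.
have mC := compact_measurable_prod cptC.
have n0 : (0 < n)%N by exact: leq_trans n3.
have lnn : ln 2 <= ln n%:R :> R.
  by rewrite ler_ln ?posrE ?ltr0n ?ler_nat //; exact: leq_trans n3.
apply: le_trans (expected_degree_ge mC cC iC indX unif n0).
rewrite lee_fin; apply: le_trans (lin n n3).
rewrite ler_pdivrMr ?(lt_le_trans ln2) // mulrAC.
by apply: ler_wpM2l => //; rewrite mulr_ge0 // ltW.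
Qed.
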